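(* The category $\mathbf{M}_S$ of symmetric continuity spaces is equivalent to the category $\mathbf{CReg}$ of completely regular topological spaces, and $\mathbf{M}_S$ is a reflective subcategory of the category $\mathbf{M}_{\mathbf{T}}$ of all continuity spaces.
   Context: For a complete lattice $L$ with bottom $\bot$ and $x,y\in L$, write $y\succ x$ (equivalently $x\prec y$; ''$y$ is well above $x$'') if whenever $S\subseteq L$ and $x\ge\bigwedge S$, there is $s\in S$ with $y\ge s$. A value distributive lattice is a completely distributive complete lattice $L$ for which $L_\prec=\{a\in L\mid a\succ\bot\}$ is a filter. A value quantale is a value distributive lattice $V$ with an associative commutative binary operation $+:V\times V\to V$ such that $x+\bot=x$ for all $x\in V$ and $\bigwedge(x+S)=x+\bigwedge S$ for all $x\in V$, $S\subseteq V$. A continuity space $(V,X,d)$ consists of a value quantale $V$, a set $X$ and a function $d:X\times X\to V$ with $d(x,x)=\bot$ and $d(x,z)\le d(x,y)+d(y,z)$ for all $x,y,z\in X$. It is symmetric if $d(x,y)=d(y,x)$ for all $x,y\in X$. $\mathbf{M}_{\mathbf{T}}$ is the category whose objects are all continuity spaces and whose morphisms $(V,X,d)\to(W,Y,m)$ are the functions $f:X\to Y$ such that for every $x\in X$ and every $\epsilon\in W_\prec$ there is $\delta\in V_\prec$ such that for all $x'\in X$, $d(x,x')\prec\delta$ implies $m(f(x),f(x'))\prec\epsilon$. $\mathbf{M}_S$ is the full subcategory of $\mathbf{M}_{\mathbf{T}}$ on the symmetric continuity spaces. $\mathbf{CReg}$ is the full subcategory of $\mathbf{Top}$ on the completely regular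 spaces (points and closed sets not containing them are separated by continuous $[0,1]$-valued functions; no $T_0$ or $T_1$ axiom is included). *)

(* Defs.v *)
From HB Require Import structures.
From mathcomp Require Import all_boot all_order all_algebra.
From mathcomp Require Import all_classical all_reals all_analysis.

Set Implicit Arguments.
Unset Strict Implicit.
Unset Printing Implicit Defensive.

Import Order.TTheory GRing.Theory Num.Theory.
Import numFieldNormedType.Exports.

Local Open Scope classical_set_scope.

Record category := Category {
  obj :> Type;
  hom : obj -> obj -> Type;
  idm : forall a, hom a a;
  cmp : forall a b c, hom b c -> hom a b -> hom a c;
  cmp1m : forall a b (f : hom a b), cmp (idm b) f = f;
  cmpm1 : forall a b (f : hom a b), cmp f (idm a) = f;
  cmpA : forall a b c d (h : hom c d) (g : hom b c) (f : hom a b),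
    cmp h (cmp g f) = cmp (cmp h g) f }.

Arguments hom {C} a b : rename.
Arguments idm {C} a : rename.
Arguments cmp {C a b c} g f : rename.

Record functor (C D : category) := Functor {
  fobj :> C -> D;
  fmap : forall a b, hom a b -> hom (fobj a) (fobj b);
  fmap1 : forall a, fmap (idm a) = idm (fobj a);
  fmapM : forall a b c (g : hom b c) (f : hom a b),
    fmap (cmp g f) = cmp (fmap g) (fmap f) }.

Arguments fmap {C D} F {a b} f : rename.

Definition functor_id (C : category) : functor C C :=
  @Functor C C id (fun _ _ f => f) (fun _ => erefl) (fun _ _ _ _ _ => erefl).

Section functor_comp.
Variables (C D E : category) (G : functor D E) (F : functor C D).

Let fmapc a b (f : hom a b) : hom (G (F a)) (G (F b)) := fmap G (fmap F f).

Lemma functor_comp1 a : fmapc (idm a) = idm (G (F a)).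
Proof. by rewrite /fmapc !fmap1. Qed.

Lemma functor_compM a b c (g : hom b c) (f : hom a b) :
  fmapc (cmp g f) = cmp (fmapc g) (fmapc f).
Proof. by rewrite /fmapc !fmapM. Qed.

Definition functor_comp : functor C E :=
  @Functor C E (fun a => G (F a)) fmapc functor_comp1 functor_compM.
End functor_comp.

Definition isomorphism (C : category) (a b : C) (f : hom a b) : Prop :=
  exists g : hom b a, cmp g f = idm a /\ cmp f g = idm b.

Definition naturally_isomorphic (C D : category) (F G : functor C D) : Prop :=
  exists t : forall a, hom (F a) (G a),
    (forall a b (f : hom a b), cmp (t b) (fmap F f) = cmp (fmap G f) (t a)) /\
    (forall a, isomorphism (t a)).

Definition equivalent_categories (C D : category) : Prop :=
  exists (F : functor C D) (G : functor D C),
    naturally_isomorphic (functor_comp G F) (functor_id C) /\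
    naturally_isomorphic (functor_comp F G) (functor_id D).

Definition left_adjoint (C D : category) (L : functor C D) (R : functor D C) :
    Prop :=
  exists phi : forall (a : C) (b : D), hom (L a) b -> hom a (R b),
    (forall a b, bijective (@phi a b)) /\
    (forall a a' b b' (f : hom a' a) (g : hom b b') (h : hom (L a) b),
      phi a' b' (cmp g (cmp h (fmap L f))) = cmp (fmap R g) (cmp (phi a b h) f)).

Definition full_subcategory (C : category) (P : C -> Prop) : category :=
  @Category {a : C | P a}
    (fun a b => hom (sval a) (sval b))
    (fun a => idm (sval a))
    (fun _ _ _ g f => cmp g f)
    (fun _ _ f => cmp1m f) (fun _ _ f => cmpm1 f)
    (fun _ _ _ _ h g f => cmpA h g f).

Definition inclusion (C : category) (P : C -> Prop) :
    functor (full_subcategory P) C :=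
  @Functor (full_subcategory P) C (fun a => sval a) (fun _ _ f => f)
    (fun _ => erefl) (fun _ _ _ _ _ => erefl).

(* The full subcategory on the objects satisfying [P] is reflective. *)
Definition reflective (C : category) (P : C -> Prop) : Prop :=
  exists L : functor C (full_subcategory P), left_adjoint L (inclusion P).

(* The display of the order only controls notations. *)
Record completeLattice := CompleteLattice {
  cl_sort :> porderType (Order.Disp tt tt);
  cinf : set cl_sort -> cl_sort;
  csup : set cl_sort -> cl_sort;
  cinfP : forall S, infimums S (cinf S);
  csupP : forall S, supremums S (csup S) }.

Arguments cinf {L} S : rename.
Arguments csup {L} S : rename.

Definition cbot (L : completeLattice) : L := csup set0.
Definition cmeet (L : completeLattice) (x y : L) : L := cinf [set x; y].

Definition well_above (L : completeLattice) (y x : L) : Prop :=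
  forall S : set L, (cinf S <= x)%O -> exists2 s, S s & (s <= y)%O.

Definition positives (L : completeLattice) : set L :=
  [set a | well_above a (cbot L)].

Arguments positives L : clear implicits.

(* [forall i, K i] is the type of choice functions. *)
Definition completely_distributive (L : completeLattice) : Prop :=
  forall (I : Type) (K : I -> Type) (x : forall i, K i -> L),
    cinf (range (fun i => csup (range (x i)))) =
    csup (range (fun f : forall i, K i => cinf (range (fun i => x i (f i))))).

(* Filters are nonempty but need not be proper: the bottom element may be well
   above itself, as in the two-element lattice. *)
Definition lattice_filter (L : completeLattice) (F : set L) : Prop :=
  [/\ F !=set0,
      forall a b, F a -> (a <= b)%O -> F b
    & forall a b, F a -> F b -> F (cmeet a b)].

Definition value_distributive (L : completeLattice) : Prop :=
  completely_distributive L /\ lattice_filter (positives L).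

Record valueQuantale := ValueQuantale {
  vq_lattice :> completeLattice;
  vq_value_distributive : value_distributive vq_lattice;
  vadd : vq_lattice -> vq_lattice -> vq_lattice;
  vaddA : associative vadd;
  vaddC : commutative vadd;
  vadd0 : forall x, vadd x (cbot vq_lattice) = x;
  vadd_inf : forall x (S : set vq_lattice),
    cinf (vadd x @` S) = vadd x (cinf S) }.

Arguments vadd {V} x y : rename.

Record continuitySpace := ContinuitySpace {
  cs_value : valueQuantale;
  cs_point :> Type;
  cs_dist : cs_point -> cs_point -> cs_value;
  cs_dist0 : forall x, cs_dist x x = cbot cs_value;
  cs_triangle : forall x y z,
    (cs_dist x z <= vadd (cs_dist x y) (cs_dist y z))%O }.

Arguments cs_dist {X} x y : rename.

Definition symmetric_space (X : continuitySpace) : Prop :=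
  forall x y : X, cs_dist x y = cs_dist y x.

Definition cs_continuous (X Y : continuitySpace) (f : X -> Y) : Prop :=
  forall (x : X) (eps : cs_value Y), positives (cs_value Y) eps ->
    exists2 delta : cs_value X, positives (cs_value X) delta &
      forall x' : X, well_above delta (cs_dist x x') ->
        well_above eps (cs_dist (f x) (f x')).

Lemma cs_continuous_id (X : continuitySpace) : @cs_continuous X X id.
Proof. by move=> x eps eps0; exists eps. Qed.

Lemma cs_continuous_comp (X Y Z : continuitySpace) (g : Y -> Z) (f : X -> Y) :
  cs_continuous g -> cs_continuous f -> cs_continuous (g \o f).
Proof.
move=> cg cf x eps /(cg (f x))[del /(cf x)[gam gam0 fP] gP].
by exists gam => // x' /fP/gP.
Qed.

Definition cs_hom (X Y : continuitySpace) := {f : X -> Y | cs_continuous f}.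

Definition cs_id (X : continuitySpace) : cs_hom X X :=
  exist _ id (@cs_continuous_id X).

Definition cs_comp (X Y Z : continuitySpace) (g : cs_hom Y Z) (f : cs_hom X Y) :
    cs_hom X Z :=
  exist _ (sval g \o sval f) (cs_continuous_comp (svalP g) (svalP f)).

Lemma cs_homP (X Y : continuitySpace) (f g : cs_hom X Y) :
  sval f = sval g -> f = g.
Proof.
by case: f g => [f cf] [g cg] /= fg; subst g; rewrite (Prop_irrelevance cf cg).
Qed.

Lemma cs_comp1m X Y (f : cs_hom X Y) : cs_comp (cs_id Y) f = f.
Proof. exact: cs_homP. Qed.

Lemma cs_compm1 X Y (f : cs_hom X Y) : cs_comp f (cs_id X) = f.
Proof. exact: cs_homP. Qed.

Lemma cs_compA X Y Z W (h : cs_hom Z W) (g : cs_hom Y Z) (f : cs_hom X Y) :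
  cs_comp h (cs_comp g f) = cs_comp (cs_comp h g) f.
Proof. exact: cs_homP. Qed.

Definition M_T : category :=
  @Category continuitySpace cs_hom cs_id cs_comp cs_comp1m cs_compm1 cs_compA.

Definition M_S : category :=
  @full_subcategory M_T symmetric_space.

Definition top_id (X : topologicalType) : continuousType X X := @idfun X.

Definition top_comp (X Y Z : topologicalType) (g : continuousType Y Z)
  (f : continuousType X Y) : continuousType X Z := g \o f.

Lemma top_comp1m (X Y : topologicalType) (f : continuousType X Y) :
  top_comp (top_id Y) f = f.
Proof. exact/continuousEP. Qed.

Lemma top_compm1 (X Y : topologicalType) (f : continuousType X Y) :
  top_comp f (top_id X) = f.
Proof. exact/continuousEP. Qed.

Lemma top_compA (X Y Z W : topologicalType) (h : continuousType Z W)
    (g : continuousType Y Z) (f : continuousType X Y) :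
  top_comp h (top_comp g f) = top_comp (top_comp h g) f.
Proof. exact/continuousEP. Qed.

(* The choice structure carried by a [topologicalType] is not seen by the
   morphisms, and every type has one classically ([gen_choiceMixin]). *)
Definition Top : category :=
  @Category topologicalType (fun X Y => continuousType X Y)
    top_id top_comp top_comp1m top_compm1 top_compA.

(* The library's [completely_regular_space] asks for separating uniformities
   instead; the two are related by [uniform_separatorP]. *)
Definition completely_regular (R : realType) (T : topologicalType) : Prop :=
  forall (a : T) (B : set T), closed B -> ~ B a ->
    exists f : T -> R,
      [/\ continuous f,
          forall x, (0 <= f x <= 1)%R,
          f a = 0%R
        & forall b, B b -> f b = 1%R].

Definition CReg (R : realType) : category :=
  @full_subcategory Top (@completely_regular R).

(* Main.v *)
Require Import Defs.
From HB Require Import structures.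
From mathcomp Require Import all_boot all_order all_algebra.
From mathcomp Require Import all_classical all_reals all_analysis.
From mathcomp Require Import lra.

Set Implicit Arguments.
Unset Strict Implicit.
Unset Printing Implicit Defensive.

Import Order.TTheory GRing.Theory Num.Theory.
Import numFieldNormedType.Exports.

Local Open Scope classical_set_scope.

(** A continuity space has a topology, generated by its open balls, and its
    morphisms are exactly the maps continuous for these topologies
    ([cs_continuousE]).  The proof compares symmetric spaces with topological
    spaces by two constructions that do not change the points, so that every
    natural map below is an identity map and the only question is whether it is
    continuous.

    From symmetric spaces to completely regular ones.  In a value quantale every
    positive element can be halved ([positive_halve]); this rests on Raney's
    description of complete distributivity, that each element is the infimum of
    the elements well above it ([cinf_well_above]), and on the positive elements
    forming a filter.  So the balls of a symmetric space define a uniformity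
    with the same topology, and uniform spaces are completely regular
    ([symmetric_completely_regular]).

    From topological spaces to symmetric spaces.  Real numbers cannot serve as
    values for spaces that are not pseudometrizable, and neither can a
    nontrivial power of the extended half-line, whose positive elements do not
    form a filter.
    Instead the distance from [x] to [y] records all pairs [(D, r)] with
    [D x y < r], where [D] runs over the continuous pseudometrics of [T] and [r]
    over the reals.  The possible values are the sets of pairs that are rounded
    (upward closed, without minimal members), ordered by reverse inclusion.
    Roundedness gives complete distributivity ([rounded_cd]) and the neutrality
    of the bottom element for the addition ([gauge_add0]); any two continuous
    pseudometrics having a common upper bound gives the filter property
    ([gauge_positives_filter]).

    The resulting symmetric space [gauge_space T] has the universal property of
    the completely regular reflection: the identity from [T] to it is continuous
    ([continuous_to_gauge]), and a continuous map from [T] to a completely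
    regular space stays continuous on it ([continuous_from_gauge]).  If [T] is
    completely regular the two topologies therefore agree, which with the first
    construction gives the equivalence; and if [T] is the ball topology of an
    arbitrary continuity space, the universal property is the adjunction. *)

(** * Complete lattices and the well-above relation *)

Section CompleteLattice.
Variable L : completeLattice.
Implicit Types (x y z : L) (S : set L).

Lemma cinf_lb S x : S x -> (cinf S <= x)%O.
Proof. by case: (cinfP S) => + _; apply. Qed.

Lemma cinf_glb S x : (forall y, S y -> (x <= y)%O) -> (x <= cinf S)%O.
Proof. by case: (cinfP S) => _; apply. Qed.

Lemma csup_ub S x : S x -> (x <= csup S)%O.
Proof. by case: (csupP S) => + _; apply. Qed.

Lemma csup_lub S x : (forall y, S y -> (y <= x)%O) -> (csup S <= x)%O.
Proof. by case: (csupP S) => _; apply. Qed.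

Lemma cmeet_lel x y : (cmeet x y <= x)%O.
Proof. by apply: cinf_lb; left. Qed.

Lemma cmeet_ler x y : (cmeet x y <= y)%O.
Proof. by apply: cinf_lb; right. Qed.

Lemma well_above_ge y x : well_above y x -> (x <= y)%O.
Proof. by move=> /(_ [set x])[]; [exact: cinf_lb|move=> s ->]. Qed.

Lemma well_above_trans_le y y' x x' :
  well_above y x -> (y <= y')%O -> (x' <= x)%O -> well_above y' x'.
Proof.
move=> yx yy' x'x S /le_trans Sx'; have [s Ss sy] := yx S (Sx' _ x'x).
by exists s => //; exact: le_trans yy'.
Qed.

(** Complete distributivity is a self-dual property.  Applying it to the family
    indexed by the choice functions [f] themselves, a choice [g] of one index
    [g f] for every [f] must exhaust some [K i]: otherwise the elements left
    over would form an [f] contradicting the choice of [g f]. *)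
Lemma completely_distributive_dual : completely_distributive L ->
  forall (I : Type) (K : I -> Type) (x : forall i, K i -> L),
    (cinf (range (fun f : forall i, K i => csup (range (fun i => x i (f i)))))
      <= csup (range (fun i => cinf (range (x i)))))%O.
Proof.
move=> cd I K x; rewrite (cd _ (fun _ => I) (fun f i => x i (f i))).
apply: csup_lub => _ [g _ <-].
have [i iP] : exists i, forall k : K i, exists2 f, g f = i & x i (f i) = x i k.
  apply: contrapT => /forallNP noi.
  have missed i : exists k : K i, forall f, g f = i -> x i (f i) <> x i k.
    have /existsNP[k kP] := noi i; exists k => f gf fk.
    by apply: kP; exists f.
  pose h i := sval (cid (missed i)).
  exact: (svalP (cid (missed (g h))) h erefl).
apply: le_trans (csup_ub _); last by exists i.
apply: cinf_glb => _ [k _ <-]; have [f gf <-] := iP k.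
by apply: cinf_lb; exists f => //; rewrite gf.
Qed.

(** The element [csup (range f)], for [f] choosing a member of each set whose
    infimum lies below [x], is well above [x] by construction; dual complete
    distributivity says that these elements have infimum [x]. *)
Lemma cinf_well_above x : completely_distributive L ->
  (cinf [set y | well_above y x] <= x)%O.
Proof.
move=> cd; pose I := {S : set L | (cinf S <= x)%O}.
pose K (i : I) := {s : L | sval i s}.
apply: le_trans (le_trans (completely_distributive_dual cd
  (fun (i : I) (k : K i) => sval k)) _).
  apply: cinf_glb => _ [f _ <-]; apply: cinf_lb => S Sx.
  by exists (sval (f (exist _ S Sx))); [exact: svalP|apply: csup_ub; eexists].
apply: csup_lub => _ [[S Sx] _ <-]; apply: (le_trans _ Sx).
apply: cinf_glb => s Ss.
by apply: cinf_lb; exists (exist _ s Ss).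
Qed.

Lemma well_above_interpolate y x : completely_distributive L ->
  well_above y x -> exists2 z, well_above y z & well_above z x.
Proof.
move=> cd yx.
have [|w [z zx wz] wy] := yx [set w | exists2 z, well_above z x & well_above w z].
  apply: le_trans (cinf_well_above x cd); apply: cinf_glb => z zx.
  apply: le_trans (cinf_well_above z cd); apply: cinf_glb => w wz.
  by apply: cinf_lb; exists z.
by exists z => //; exact: well_above_trans_le wz wy _.
Qed.

End CompleteLattice.

(** * Value quantales *)

Section ValueQuantale.
Variable V : valueQuantale.
Implicit Types (x y e : V).

Let cd : completely_distributive V := (vq_value_distributive V).1.

Lemma positives_neq0 : positives V !=set0.
Proof. by case: (vq_value_distributive V).2. Qed.

Lemma positives_cmeet e e' :
  positives V e -> positives V e' -> positives V (cmeet e e').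
Proof. by case: (vq_value_distributive V).2 => _ _; apply. Qed.

Lemma ler_vadd x y y' : (y <= y')%O -> (vadd x y <= vadd x y')%O.
Proof.
(* Distributivity over the infimum of a comparable pair gives monotonicity. *)
move=> yy'; have -> : y = cinf [set y; y'].
  apply/le_anti/andP; split; last by apply: cinf_lb; left.
  by apply: cinf_glb => z [->|->].
by rewrite -vadd_inf; apply: cinf_lb; exists y' => //; right.
Qed.

Lemma cinf_vadd_positives x : (cinf (vadd x @` positives V) <= x)%O.
Proof. by rewrite vadd_inf -{2}(vadd0 x); apply/ler_vadd/cinf_well_above. Qed.

(** Room for the triangle inequality: open balls are neighbourhoods of their
    points because of this lemma. *)
Lemma well_above_vadd e x : well_above e x ->
  exists2 d, positives V d & well_above e (vadd x d).
Proof.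
move=> /(well_above_interpolate cd)[z ez zx].
have [_ [d d0 <-] dz] := zx _ (cinf_vadd_positives x).
by exists d => //; exact: well_above_trans_le ez _ dz.
Qed.

(** Room found twice above the bottom element gives two positive summands; their
    meet, positive because the positive elements form a filter, replaces both. *)
Lemma positive_halve e : positives V e ->
  exists2 d, positives V d & well_above e (vadd d d).
Proof.
move=> /well_above_vadd[a a0]; rewrite vaddC vadd0 => /well_above_vadd[b b0 eab].
exists (cmeet a b); first exact: positives_cmeet.
apply: well_above_trans_le eab _ _ => //.
apply: le_trans (ler_vadd _ (cmeet_ler a b)) _.
by rewrite vaddC [leRHS]vaddC; apply: ler_vadd; exact: cmeet_lel.
Qed.

End ValueQuantale.

(** * The topology of open balls *)

(** A copy of the points, to carry the topology: when the points already are
    those of a topological space, the two topologies must be kept apart. *)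
Definition ball_space (X : continuitySpace) : Type := cs_point X.

Section BallSpace.
Variable X : continuitySpace.
Implicit Types (x y : X) (e : cs_value X).

Definition cs_ball x e : set X := [set y | well_above e (cs_dist x y)].

Definition cs_nbhs x : set_system X :=
  [set A | exists2 e, positives _ e & cs_ball x e `<=` A].

Lemma cs_ball_center x e : positives _ e -> cs_ball x e x.
Proof. by rewrite /cs_ball /= cs_dist0. Qed.

Lemma cs_ball_add x y z (d d' : cs_value X) e :
  well_above e (vadd d d') -> (cs_dist x y <= d)%O -> (cs_dist y z <= d')%O ->
  cs_ball x e z.
Proof.
move=> edd' xy yz.
apply: well_above_trans_le edd' _ _ => //.
apply: le_trans (cs_triangle _ y _) _; apply: le_trans (ler_vadd _ yz) _.
by rewrite vaddC [leRHS]vaddC; apply: ler_vadd.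
Qed.

Lemma cs_ball_meet x e e' :
  cs_ball x (cmeet e e') `<=` cs_ball x e `&` cs_ball x e'.
Proof.
by move=> y xy; split; apply: well_above_trans_le xy _ _ => //;
  [exact: cmeet_lel|exact: cmeet_ler].
Qed.

Lemma cs_nbhs_filter x : ProperFilter (cs_nbhs x).
Proof.
apply: Build_ProperFilter_ex.
  by move=> A [e e0 eA]; exists x; apply/eA/cs_ball_center.
split.
- by have [e e0] := positives_neq0 (cs_value X); exists e.
- move=> A B [e e0 eA] [e' e'0 eB]; exists (cmeet e e').
    exact: positives_cmeet.
  by move=> y /cs_ball_meet[/eA Ay /eB By].
- by move=> A B AB [e e0 eA]; exists e => // y /eA/AB.
Qed.

Lemma cs_nbhs_singleton x A : cs_nbhs x A -> A x.
Proof. by move=> [e e0]; apply; exact: cs_ball_center. Qed.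

Lemma cs_nbhs_nbhs x A : cs_nbhs x A -> cs_nbhs x (cs_nbhs^~ A).
Proof.
move=> [e e0 eA]; exists e => // y /well_above_vadd[d d0 ed].
exists d => // z yz; apply: eA; apply: (cs_ball_add ed) => //.
exact: well_above_ge.
Qed.

HB.instance Definition _ := gen_eqMixin (ball_space X).
HB.instance Definition _ := gen_choiceMixin (ball_space X).
HB.instance Definition _ := hasNbhs.Build (ball_space X) cs_nbhs.
HB.instance Definition _ := Nbhs_isNbhsTopological.Build (ball_space X)
  cs_nbhs_filter cs_nbhs_singleton cs_nbhs_nbhs.

End BallSpace.

(** The balls of positive radius are a base of neighbourhoods of their centre, so
    this is the usual epsilon-delta characterization of continuity. *)
Lemma cs_continuousE (X Y : continuitySpace) (f : X -> Y) :
  cs_continuous f <-> continuous (f : ball_space X -> ball_space Y).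
Proof.
split=> [cf x A [e e0 eA]|cf x e e0].
  by have [d d0 dP] := cf x e e0; exists d => // y /dP/eA.
have [|d d0 dP] := cf x (cs_ball (f x) e); first by exists e.
by exists d.
Qed.

(** * Symmetric continuity spaces are uniformizable *)

Section Symmetric.
Variables (X : continuitySpace) (symX : symmetric_space X).

(** Symmetry of the distance gives the inverses of entourages, and the halving
    of positive elements gives their square roots. *)
Definition cs_entourage : set_system (ball_space X * ball_space X) :=
  [set A | exists2 e, positives (cs_value X) e &
    forall x y, cs_ball x e y -> A (x, y)].

Lemma cs_entourage_filter : Filter cs_entourage.
Proof.
split.
- by have [e e0] := positives_neq0 (cs_value X); exists e.
- move=> A B [e e0 eA] [e' e'0 eB]; exists (cmeet e e').
    exact: positives_cmeet.
  by move=> x y /cs_ball_meet[/eA Ay /eB By].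
- by move=> A B AB [e e0 eA]; exists e => // x y /eA/AB.
Qed.

Lemma cs_entourage_diagonal A : cs_entourage A -> diagonal `<=` A.
Proof.
move=> [e e0 eA] [x y] xy; have <- : x = y := xy.
exact/eA/cs_ball_center.
Qed.

Lemma cs_entourage_inv A : cs_entourage A -> cs_entourage A^-1%relation.
Proof.
move=> [e e0 eA]; exists e => // x y; rewrite /cs_ball /= symX; exact: eA.
Qed.

Lemma cs_entourage_split A : cs_entourage A ->
  exists2 B, cs_entourage B & (B \; B)%relation `<=` A.
Proof.
move=> [e /positive_halve[d d0 ed] eA].
exists [set xy | cs_ball xy.1 d xy.2]; first by exists d.
move=> [x z] [y /= xy yz]; apply: eA.
exact: cs_ball_add ed (well_above_ge xy) (well_above_ge yz).
Qed.

Lemma cs_nbhs_entourage : @nbhs _ (ball_space X) = nbhs_ cs_entourage.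
Proof.
apply/funext => x; rewrite nbhs_E; apply/seteqP; split=> A.
  move=> [e e0 eA]; exists [set xy | cs_ball xy.1 e xy.2]; first by exists e.
  by move=> y /xsectionP/eA.
by move=> [B [e e0 eB] BA]; exists e => // y /eB xy; apply: BA; exact/xsectionP.
Qed.

Lemma symmetric_completely_regular (R : realType) :
  completely_regular R (ball_space X).
Proof.
(* The uniformity is added on top of the ball topology, so that closed sets
   and continuity mean the same thing for [U] and for [ball_space X]. *)
pose mixin := Nbhs_isUniform_mixin.Build (ball_space X) cs_entourage_filter
  cs_entourage_diagonal cs_entourage_inv cs_entourage_split cs_nbhs_entourage.
pose U : uniformType := HB.pack (ball_space X) mixin.
move=> a B clB Ba.
have /(@uniform_separatorP _ R)[f [cf f01 f0 f1]] :=
  @uniform_completely_regular R U a B clB Ba.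
exists f; split=> [//|x||b Bb].
- by have := f01 _ (imageP f (I : setT x)); rewrite /= in_itv.
- by apply: f0; exists a.
- by apply: f1; exists b.
Qed.

End Symmetric.

(** * Rounded sets *)

(** When [lt] is transitive and interpolative, [(E, lt)] is an abstract basis
    and its rounded sets are the lattices of Raney's representation of
    completely distributive lattices. *)
Section Rounded.
Variables (E : Type) (lt : E -> E -> Prop).

Definition rounded (p : set E) :=
  forall e, p e <-> exists2 e', p e' & lt e' e.

Definition rounded_set : Type := {p : set E | rounded p}.

Implicit Types (p q : rounded_set) (S : set rounded_set).

(** Inclusion is reversed because a distance is represented by the set of its
    strict upper bounds. *)
Definition rounded_le p q : bool := `[< sval q `<=` sval p >].

HB.instance Definition _ := gen_eqMixin rounded_set.
HB.instance Definition _ := gen_choiceMixin rounded_set.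

Lemma rounded_set_eq p q : sval p = sval q -> p = q.
Proof.
by case: p q => [p pP] [q qP] /= pq; subst q; rewrite (Prop_irrelevance pP qP).
Qed.

Lemma rounded_le_refl : reflexive rounded_le.
Proof. by move=> p; apply/asboolP. Qed.

Lemma rounded_le_anti : antisymmetric rounded_le.
Proof.
move=> p q /andP[/asboolP qp /asboolP pq].
by apply: rounded_set_eq; exact/seteqP.
Qed.

Lemma rounded_le_trans : transitive rounded_le.
Proof.
move=> q p r /asboolP qp /asboolP rq.
by apply/asboolP; exact: subset_trans rq qp.
Qed.

HB.instance Definition _ := Order.Le_isPOrder.Build (Order.Disp tt tt)
  rounded_set rounded_le_refl rounded_le_anti rounded_le_trans.

Lemma rounded_leP p q : reflect (sval q `<=` sval p) (p <= q)%O.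
Proof. exact: asboolP. Qed.

Lemma rounded_inf_subproof S : rounded [set e | exists2 p, S p & sval p e].
Proof.
move=> e; split=> [[p Sp /(svalP p)[e' pe' e'e]]|[e' [p Sp pe'] e'e]].
  by exists e' => //; exists p.
by exists p => //; apply/(svalP p); exists e'.
Qed.

Definition rounded_inf S : rounded_set := exist _ _ (rounded_inf_subproof S).

Lemma rounded_infP S : infimums S (rounded_inf S).
Proof.
split=> [p Sp|q qS]; apply/rounded_leP; first by move=> e pe; exists p.
by move=> e [p /qS/rounded_leP]; apply.
Qed.

Hypothesis lt_trans : forall a b c, lt a b -> lt b c -> lt a c.
Hypothesis lt_interpolate : forall a c, lt a c -> exists2 b, lt a b & lt b c.

Lemma rounded_sup_subproof S :
  rounded [set e | exists2 e', lt e' e & forall p, S p -> sval p e'].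
Proof.
move=> e; split=> [[a ae Sa]|[b [a ab Sa] be]]; last first.
  by exists a => //; exact: lt_trans be.
by have [b ab be] := lt_interpolate ae; exists b => //; exists a.
Qed.

(** Suprema are not intersections: they are the rounded interiors of these. *)
Definition rounded_sup S : rounded_set := exist _ _ (rounded_sup_subproof S).

Lemma rounded_supP S : supremums S (rounded_sup S).
Proof.
split=> [p Sp|q qS]; apply/rounded_leP => e.
  by move=> [e' e'e Se']; apply/(svalP p); exists e' => //; exact: Se'.
move=> /(svalP q)[e' qe' e'e]; exists e' => // p /qS/rounded_leP.
exact.
Qed.

Definition rounded_lattice : completeLattice :=
  CompleteLattice rounded_infP rounded_supP.

(** The inclusion that is not formal: if [e'] misses some [x i k] for each [i],
    these [k] form a choice function [f] such that [e'] lies in no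
    [x i (f i)].  Passing from [e] to some [e'] below it turns membership in a
    rounded interior into membership in the intersection itself. *)
Lemma rounded_cd : completely_distributive rounded_lattice.
Proof.
move=> I K x; apply/rounded_set_eq/seteqP; split=> e /=.
  move=> [_ [i _ <-] [e' e'e xe']]; exists e' => // _ [f _ <-].
  exists (x i (f i)); first by exists i.
  by apply: xe'; exists (f i).
move=> [e' e'e xe'].
have [i xi] : exists i, forall k, sval (x i k) e'.
  apply: contrapT => /forallNP noi.
  have missed i : exists k, ~ sval (x i k) e' by exact/existsNP.
  pose f i := sval (cid (missed i)).
  have [|_ [i _ <-]] := xe' (rounded_inf (range (fun i => x i (f i)))).
    by exists f.
  exact: svalP (cid (missed i)).
exists (rounded_sup (range (x i))); first by exists i.
by exists e' => // _ [k _ <-].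
Qed.

Lemma rounded_up_subproof a : rounded (lt a).
Proof.
by move=> e; split=> [/lt_interpolate|[e' ae' e'e]] //; exact: lt_trans e'e.
Qed.

Definition rounded_up a : rounded_set := exist _ _ (rounded_up_subproof a).

(** Every rounded set is the union, that is the infimum, of the principal ones
    at its elements; hence these principal sets decide what is well above. *)
Lemma rounded_well_above (p q : rounded_lattice) :
  well_above p q <-> exists2 a, sval q a & sval p `<=` lt a.
Proof.
split=> [/(_ (rounded_up @` sval q))[]|[a qa pa] S /rounded_leP/(_ a qa)[s Ss sa]].
- apply/rounded_leP => e /(svalP q)[a qa ae].
  by exists (rounded_up a) => //; exists a.
- by move=> _ [a qa <-] /rounded_leP pa; exists a.
- exists s => //; apply/rounded_leP => e /pa ae.
  by apply/(svalP s); exists a.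
Qed.

Lemma rounded_cbot e : (exists a, lt a e) -> sval (cbot rounded_lattice) e.
Proof. by move=> [a ae]; exists a. Qed.

End Rounded.

(** * The value quantale of a directed family of gauges *)

(** A nonempty directed preorder; its elements index the gauges, a larger index
    standing for a finer gauge. *)
Record directed := Directed {
  dir_sort :> Type;
  dle : dir_sort -> dir_sort -> Prop;
  dle_refl : forall i, dle i i;
  dle_trans : forall i j k, dle i j -> dle j k -> dle i k;
  dir_inhabited : inhabited dir_sort;
  dir_ub : forall i j, exists k, dle i k /\ dle j k }.

Section GaugeQuantale.
Variables (R : realType) (I : directed).
Local Open Scope ring_scope.
Implicit Types (i j k : I) (r s : R).

(** The pair [(i, r)] stands for the assertion that the gauge [i] is less than
    [r]: lower pairs are stronger assertions, being about finer gauges and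
    smaller bounds.  As [0 < a.2] is required of the smaller pair, all members
    of a rounded set have a positive bound. *)
Definition gauge_lt (a b : I * R) : Prop :=
  [/\ dle b.1 a.1, 0 < a.2 & a.2 < b.2].

Lemma gauge_lt_trans a b c : gauge_lt a b -> gauge_lt b c -> gauge_lt a c.
Proof.
move=> [ba a0 ab] [cb b0 bc]; split=> //; first exact: dle_trans cb ba.
exact: lt_trans bc.
Qed.

Lemma gauge_lt_interpolate a c :
  gauge_lt a c -> exists2 b, gauge_lt a b & gauge_lt b c.
Proof.
move=> [ca a0 ac]; exists (a.1, (a.2 + c.2) / 2).
  by split=> //=; [exact: dle_refl|lra].
by split=> //=; lra.
Qed.

Let L : completeLattice := rounded_lattice gauge_lt_trans gauge_lt_interpolate.

Implicit Types (p q : L) (S : set L).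

Lemma gauge_up p i j r s : sval p (i, r) -> dle j i -> r < s -> sval p (j, s).
Proof.
move=> pir ji rs; have /(svalP p)[[k t] pkt [/= ik t0 tr]] := pir.
apply/(svalP p); exists (k, t) => //; split=> //=; first exact: dle_trans ji ik.
exact: lt_trans rs.
Qed.

Lemma gauge_gt0 p i r : sval p (i, r) -> 0 < r.
Proof. by move=> /(svalP p)[[k t] _ [/= _]]; exact: lt_trans. Qed.

Lemma gauge_shrink p i r : sval p (i, r) -> exists2 s, sval p (i, s) & s < r.
Proof.
move=> /(svalP p)[[k t] pkt [/= ik t0 tr]]; exists ((t + r) / 2); last by lra.
by apply: (gauge_up pkt) => //; lra.
Qed.

Lemma gauge_cbot i r : 0 < r -> sval (cbot L) (i, r).
Proof.
move=> r0; apply: rounded_cbot; exists (i, r / 2).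
by split=> /=; [exact: dle_refl|lra|lra].
Qed.

(** Addition adds the bounds gauge by gauge: [d x y < r] and [d y z < s] yield
    [d x z < t] as soon as [r + s <= t]. *)
Lemma gauge_add_subproof p q : rounded gauge_lt
  [set e | exists r s, [/\ sval p (e.1, r), sval q (e.1, s) & r + s <= e.2]].
Proof.
move=> [i t]; split=> /=.
  move=> [r [s [pr qs rst]]].
  have [r' pr' r'r] := gauge_shrink pr; have [s' ps' s's] := gauge_shrink qs.
  have r'0 := gauge_gt0 pr'; have s'0 := gauge_gt0 ps'.
  exists (i, r' + s'); first by exists r', s'.
  by split=> /=; [exact: dle_refl|lra|lra].
(* Each summand absorbs half of the gap between [t'] and [t], since a bound can
   be transferred to a coarser gauge only by increasing it. *)
move=> [[j t'] /= [r [s [pr qs rst]]] [/= ij t'0 t't]].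
exists (r + (t - t') / 2), (s + (t - t') / 2); split; last by lra.
  by apply: (gauge_up pr) => //; lra.
by apply: (gauge_up qs) => //; lra.
Qed.

Definition gauge_add p q : L := exist _ _ (gauge_add_subproof p q).

Lemma gauge_addC : commutative gauge_add.
Proof.
suff sub p q : sval (gauge_add p q) `<=` sval (gauge_add q p).
  by move=> p q; apply/rounded_set_eq/seteqP; split; exact: sub.
by move=> e [r [s [pr qs rs]]]; exists s, r; split=> //; rewrite addrC.
Qed.

Lemma gauge_addA : associative gauge_add.
Proof.
move=> p q u; apply/rounded_set_eq/seteqP; split=> -[i t] /=.
  move=> [r [v [pr [s [w [qs uw /= sw]] rt]]]].
  by exists (r + s), w; split=> //; [exists r, s|lra].
move=> [v [w [[r [s [pr qs /= rs]]] uw rt]]].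
by exists r, (s + w); split=> //; [exists s, w|lra].
Qed.

(** The bottom element asserts all positive bounds, so adding it can only
    increase a bound; since [p] is rounded, each of its bounds is obtained in
    this way from a smaller one. *)
Lemma gauge_add0 p : gauge_add p (cbot L) = p.
Proof.
apply/rounded_set_eq/seteqP; split=> -[i t].
  move=> [r [s [pr /gauge_gt0 s0 /= rst]]].
  by apply: (gauge_up pr); [exact: dle_refl|lra].
move=> /gauge_shrink[r pr rt]; exists r, (t - r); split=> //.
- by apply: gauge_cbot; lra.
- by rewrite /=; lra.
Qed.

Lemma gauge_add_inf p S : cinf (gauge_add p @` S) = gauge_add p (cinf S).
Proof.
apply/rounded_set_eq/seteqP; split=> e /=.
  by move=> [_ [q Sq <-] [r [s [pr qs rs]]]]; exists r, s; split=> //; exists q.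
move=> [r [s [pr [q Sq qs] rs]]]; exists (gauge_add p q); first by exists q.
by exists r, s.
Qed.

Lemma gauge_positiveP p :
  positives L p <-> exists i r, 0 < r /\ sval p `<=` gauge_lt (i, r).
Proof.
split=> [/rounded_well_above[[i r] /gauge_gt0 r0 pr]|[i [r [r0 pr]]]].
  by exists i, r.
by apply/rounded_well_above; exists (i, r) => //; exact: gauge_cbot.
Qed.

Definition gauge_up_set i r : L :=
  rounded_up gauge_lt_trans gauge_lt_interpolate (i, r).

Lemma gauge_up_set_positive i r : 0 < r -> positives L (gauge_up_set i r).
Proof. by move=> r0; apply/gauge_positiveP; exists i, r; split. Qed.

(** The meet of two positive elements is their union, so this is where the
    gauges have to be directed. *)
Lemma gauge_positives_filter : lattice_filter (positives L).
Proof.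
split.
- have [i] := dir_inhabited I.
  by exists (gauge_up_set i 1); exact: gauge_up_set_positive.
- by move=> p q p0 pq; exact: well_above_trans_le p0 pq _.
move=> p q /gauge_positiveP[i [r [r0 pr]]] /gauge_positiveP[j [s [s0 qs]]].
have [k [ik jk]] := dir_ub i j.
apply/gauge_positiveP; exists k, (Num.min r s); split; first by rewrite lt_min r0.
move=> e [u [->|->]]; [move/pr => -[/= ei _ re]|move/qs => -[/= ej _ se]].
- split=> /=; [exact: dle_trans ei ik|by rewrite lt_min r0|].
  by rewrite gt_min re.
- split=> /=; [exact: dle_trans ej jk|by rewrite lt_min r0|].
  by rewrite gt_min se orbT.
Qed.

Definition gauge_quantale : valueQuantale :=
  @ValueQuantale L
    (conj (@rounded_cd _ _ gauge_lt_trans gauge_lt_interpolate)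
          gauge_positives_filter)
    gauge_add gauge_addA gauge_addC gauge_add0 gauge_add_inf.

End GaugeQuantale.

(** * Continuous pseudometrics *)

Section Pseudometric.
Variables (R : realType) (T : topologicalType).
Local Open Scope ring_scope.

(** Continuity is required only at the diagonal, from which the triangle
    inequality spreads it to all pairs of points. *)
Record pseudometric := Pseudometric {
  pm :> T -> T -> R;
  pm_refl : forall x, pm x x = 0;
  pm_sym : forall x y, pm x y = pm y x;
  pm_triangle : forall x y z, pm x z <= pm x y + pm y z;
  pm_near : forall x (r : R), 0 < r -> \forall y \near x, pm x y < r }.

Implicit Types D : pseudometric.

Lemma pm_ge0 D x y : 0 <= D x y.
Proof. by have := pm_triangle D x y x; rewrite pm_refl (pm_sym D y x); lra. Qed.

Definition pm_le D D' := forall x y, D x y <= D' x y.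

Lemma pm_inhabited : inhabited pseudometric.
Proof.
apply: inhabits; apply: (@Pseudometric (fun _ _ => 0)) => //.
by move=> x r r0; near=> y.
Unshelve. all: by end_near. Qed.

(** The sum is a more convenient upper bound than the maximum: its triangle
    inequality is linear. *)
Lemma pm_ub D D' : exists D'', pm_le D D'' /\ pm_le D' D''.
Proof.
unshelve eexists (@Pseudometric (fun x y => D x y + D' x y) _ _ _ _).
- by move=> x; rewrite /= !pm_refl addr0.
- by move=> x y; rewrite /= (pm_sym D) (pm_sym D').
- by move=> x y z; have := pm_triangle D x y z; have := pm_triangle D' x y z; lra.
- move=> x r r0; have r20 : 0 < r / 2 by lra.
  by near do rewrite [ltRHS]splitr ltrD//; exact: pm_near.
by split=> x y /=; rewrite ?lerDl ?lerDr pm_ge0.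
Unshelve. all: by end_near. Qed.

Definition pm_directed : directed :=
  @Directed pseudometric pm_le (fun D x y => lexx (D x y))
    (fun D1 D2 D3 le12 le23 x y => le_trans (le12 x y) (le23 x y))
    pm_inhabited pm_ub.

Lemma dist_near (g : T -> R) : continuous g ->
  forall x r, 0 < r -> \forall y \near x, `|g x - g y| < r.
Proof. by move=> cg x r r0; exact: cvgr_dist_lt (cg x) r r0. Qed.

Definition pm_dist (g : T -> R) (cg : continuous g) : pseudometric.
Proof.
apply: (@Pseudometric (fun x y => `|g x - g y|)).
- by move=> x; rewrite subrr normr0.
- by move=> x y; rewrite distrC.
- by move=> x y z; exact: ler_distD.
- exact: dist_near.
Defined.

(** * The gauge space of a topological space *)

Let V := gauge_quantale R pm_directed.

Lemma gauge_dist_subproof x y :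
  rounded (@gauge_lt R pm_directed) [set e | (e.1 : pseudometric) x y < e.2].
Proof.
move=> [D r]; split=> /= [Dr|[[D' s] /= D's [/= DD' s0 sr]]]; last first.
  exact: le_lt_trans (DD' x y) (lt_trans D's sr).
have D0 := pm_ge0 D x y.
exists (D, (D x y + r) / 2); first by rewrite /=; lra.
by split=> /=; [move=> *; exact: lexx|lra|lra].
Qed.

Definition gauge_dist (x y : T) : V := exist _ _ (gauge_dist_subproof x y).

Lemma gauge_dist0 x : gauge_dist x x = cbot V.
Proof.
apply/rounded_set_eq/seteqP; split=> -[D r].
  by move=> Dr; apply: gauge_cbot; rewrite -(pm_refl D x).
by move/gauge_gt0; rewrite /= pm_refl.
Qed.

Lemma gauge_dist_triangle x y z :
  (gauge_dist x z <= vadd (gauge_dist x y) (gauge_dist y z))%O.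
Proof.
apply/rounded_leP => -[D t] /= [r [s [/= xy yz rst]]].
by have := pm_triangle D x y z; lra.
Qed.

Definition gauge_space : continuitySpace :=
  ContinuitySpace gauge_dist0 gauge_dist_triangle.

Lemma gauge_space_symmetric : symmetric_space gauge_space.
Proof.
move=> x y; apply/rounded_set_eq/funext => -[D r] /=.
by rewrite pm_sym.
Qed.

(** To be in a given ball it suffices to satisfy one positive bound on one
    continuous pseudometric, by [gauge_positiveP]. *)
Lemma continuous_to_gauge : continuous (id : T -> ball_space gauge_space).
Proof.
move=> x A [p /gauge_positiveP[D [r [r0 pr]]] pA].
have : nbhs x [set y | (D : pseudometric) x y < r] by exact: pm_near.
apply: filterS => y Dr; apply: pA; apply/rounded_well_above.
by exists (D, r).
Qed.

(** A neighbourhood of [f x] contains the points where a function [g] vanishing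
    at [f x] is less than [1]; pulled back along [f], the function [g] gives the
    continuous pseudometric [`|g (f x) - g (f y)|], and its balls are
    neighbourhoods in the gauge space. *)
Lemma continuous_from_gauge (S : topologicalType) (f : T -> S) :
  completely_regular R S -> continuous f ->
  continuous (f : ball_space gauge_space -> S).
Proof.
move=> crS cf x A; rewrite {1}nbhsE => -[U [oU Ufx] UA].
have [//|g [cg g01 g0 g1]] := crS (f x) (~` U) (open_closedC oU).
have cgf : continuous (g \o f).
  by move=> y; apply: continuous_comp; [exact: cf|exact: cg].
(* Any radius below [1] would do: values below [gauge_up_set _ (1 / 2)] contain
   the bound [1]. *)
exists (gauge_up_set (pm_dist cgf : pm_directed) (1 / 2)).
  by apply: gauge_up_set_positive; lra.
move=> y /well_above_ge/rounded_leP/(_ (pm_dist cgf : pm_directed, 1)).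
rewrite /= g0 sub0r normrN => gy; apply: UA; apply: contrapT => /g1 gfy.
suff : `|g (f y)| < 1 by rewrite gfy normr1 ltxx.
by apply: gy; split=> /=; [move=> *; exact: lexx|lra|lra].
Qed.

End Pseudometric.

(** * The functors *)

Definition top_hom (X Y : topologicalType) (f : X -> Y) (cf : continuous f) :
  continuousType X Y := mkcts cf.

Definition ball_map (X Y : continuitySpace) (f : cs_hom X Y) :
    continuousType (ball_space X) (ball_space Y) :=
  top_hom ((cs_continuousE (sval f)).1 (svalP f)).

Lemma ball_map1 (X : M_T) : ball_map (cs_id X) = top_id (ball_space X).
Proof. exact/continuousEP. Qed.

Lemma ball_mapM (X Y Z : M_T) (g : cs_hom Y Z) (f : cs_hom X Y) :
  ball_map (cs_comp g f) = top_comp (ball_map g) (ball_map f).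
Proof. exact/continuousEP. Qed.

Definition ball_functor : functor M_T Top :=
  @Functor M_T Top (fun X => ball_space X) ball_map ball_map1 ball_mapM.

Section Functors.
Variable R : realType.

(** The gauge space of [T] is itself completely regular, so the universal
    property applies to the map [f] followed by the identity from [T] to its
    gauge space. *)
Lemma gauge_continuous (S T : topologicalType) (f : S -> T) :
  continuous f ->
  cs_continuous (f : gauge_space R S -> gauge_space R T).
Proof.
move=> cf; apply/cs_continuousE; apply: continuous_from_gauge.
  exact/symmetric_completely_regular/gauge_space_symmetric.
by move=> x A /continuous_to_gauge/cf.
Qed.

Definition gauge_map (S T : topologicalType) (f : continuousType S T) :
    cs_hom (gauge_space R S) (gauge_space R T) :=
  exist _ (f : S -> T) (gauge_continuous (@cts_fun _ _ f)).

Lemma gauge_map1 (T : Top) : gauge_map (top_id T) = cs_id (gauge_space R T).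
Proof. exact: cs_homP. Qed.

Lemma gauge_mapM (S T U : Top) (g : continuousType T U)
    (f : continuousType S T) :
  gauge_map (top_comp g f) = cs_comp (gauge_map g) (gauge_map f).
Proof. exact: cs_homP. Qed.

Definition gauge_functor : functor Top M_S :=
  @Functor Top M_S
    (fun T => exist _ (gauge_space R T : M_T) (@gauge_space_symmetric R T))
    gauge_map gauge_map1 gauge_mapM.

Definition symmetric_ball_functor : functor M_S (CReg R) :=
  @Functor M_S (CReg R)
    (fun X => exist _ (ball_space (sval X) : Top)
       (symmetric_completely_regular (svalP X) R))
    (fun X Y => @ball_map (sval X) (sval Y))
    (fun X => ball_map1 (sval X))
    (fun X Y Z => @ball_mapM (sval X) (sval Y) (sval Z)).

(** The hom-set bijection of the reflection, at the level of maps: the ball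
    topology of a symmetric space is completely regular, hence the universal
    property of the gauge space applies. *)
Lemma gauge_reflection (X Y : continuitySpace) (f : X -> Y) :
  symmetric_space Y ->
  cs_continuous (f : gauge_space R (ball_space X) -> Y) <-> cs_continuous f.
Proof.
move=> symY; split=> /cs_continuousE cf; apply/cs_continuousE.
  by move=> x A /cf/continuous_to_gauge.
exact: (@continuous_from_gauge R (ball_space X) (ball_space Y) f)
  (symmetric_completely_regular symY R) cf.
Qed.

Lemma symmetric_reflective : @reflective M_T symmetric_space.
Proof.
exists (functor_comp gauge_functor ball_functor).
exists (fun (X : M_T) (Y : M_S)
    (h : cs_hom (gauge_space R (ball_space X)) (sval Y)) =>
  exist _ (sval h) ((gauge_reflection (X := X) (sval h) (svalP Y)).1 (svalP h))
    : cs_hom X (sval Y)).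
split=> [X Y|X X' Y Y' f g h]; last exact: cs_homP.
exists (fun h : cs_hom X (sval Y) =>
  exist _ (sval h) ((gauge_reflection (X := X) (sval h) (svalP Y)).2 (svalP h))
    : cs_hom (gauge_space R (ball_space X)) (sval Y)) => h; exact: cs_homP.
Qed.

Lemma symmetric_equivalent : equivalent_categories M_S (CReg R).
Proof.
exists symmetric_ball_functor,
  (functor_comp gauge_functor (@inclusion Top (@completely_regular R))).
split.
- pose t (X : M_S) : cs_hom (gauge_space R (ball_space (sval X))) (sval X) :=
    exist _ id ((gauge_reflection (X := sval X) id (svalP X)).2
      (@cs_continuous_id (sval X))).
  exists t; split=> [X Y f|X]; first exact: cs_homP.
  have ct : cs_continuous (id : sval X -> gauge_space R (ball_space (sval X))).
    exact/cs_continuousE/continuous_to_gauge.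
  exists (exist _ id ct : cs_hom (sval X) (gauge_space R (ball_space (sval X)))).
  by split; exact: cs_homP.
- pose t (T : CReg R) :
      continuousType (ball_space (gauge_space R (sval T))) (sval T) :=
    top_hom (continuous_from_gauge (svalP T) (fun x : sval T => @cvg_id _ _)).
  exists t; split=> [S T f|T]; first exact/continuousEP.
  exists (top_hom (@continuous_to_gauge R (sval T))).
  by split; exact/continuousEP.
Qed.

End Functors.

Theorem corollary20 (R : realType) :
  equivalent_categories M_S (CReg R) /\ @reflective M_T symmetric_space.
Proof.
by split; [exact: symmetric_equivalent|exact: (symmetric_reflective R)].
Qed.
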